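(* Let $q,b$ be complex numbers with $|q|<1$ and $b\neq -q^{-N}$ for any positive integer $N$. Then for all positive integers $m$ and $n$, $$\sum_{0\leq a_1\leq a_2\leq \dots \leq a_n}\frac{q^{m(a_1+a_2+\dots +a_n)}}{\prod_{j=0}^{n-1}\prod_{k=1}^{m+1}\left(1+bq^{j(m+1)+k+a_{j+1}}\right)}=\frac{1}{(q^m;q^m)_n\,(-bq;q)_{mn}},$$ where the sum is over all $n$-tuples $(a_1,\dots,a_n)$ of integers satisfying $0\leq a_1\leq a_2\leq\dots\leq a_n$.
   Context: Notation: $(x;q)_0=1$ and $(x;q)_n=\prod_{j=0}^{n-1}(1-xq^{j})$ for $n\ge 1$; thus $(q^m;q^m)_n=\prod_{j=1}^{n}(1-q^{mj})$ and $(-bq;q)_{mn}=\prod_{j=1}^{mn}(1+bq^{j})$. The condition $b\ne -q^{-N}$ means $1+bq^N\neq 0$. *)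

(* Defs.v *)
From HB Require Import structures.
From mathcomp Require Export all_boot all_order all_algebra.
From mathcomp Require Export finmap.
From mathcomp Require Export complex.
From mathcomp Require Export boolp classical_sets reals topology normedtype.
(* Loaded without Import: it defines a constant [sum] that would shadow the
   sum type. *)
From mathcomp Require showcase.summability.

Set Implicit Arguments.
Unset Strict Implicit.
Unset Printing Implicit Defensive.
Import Order.TTheory GRing.Theory Num.Theory.
Export numFieldNormedType.Exports.

Local Open Scope ring_scope.

Definition qpoch (F : comNzRingType) (x q : F) (n : nat) : F :=
  \prod_(j < n) (1 - x * q ^+ j).

Definition ndtuple (n : nat) : choiceType :=
  {a : n.-tuple nat | sorted leq a}.

(* [R[i]^o] is the complex field with the topology of its modulus, and
   [summability.totally] is the filter of all large enough finite sets of
   indices: the family [f] is unconditionally (equivalently, absolutely)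
   summable, with sum [s]. *)
Definition has_sum (R : realType) (I : choiceType) (f : I -> R[i]) (s : R[i])
    : Prop :=
  (summability.partial_sum f @ summability.totally --> (s : R[i]^o))%classic.

(* Main.v *)
(* Write [t_j(a)] for the [j]-th factor of the summand and
     c_n(j, a) = q^(mna) / ((q^m; q^m)_n prod_(1 <= k <= mn) (1 + b q^(j(m+1)+k+a)))
   for the expected sum over [a <= a_1 <= ... <= a_n] of
   t_j(a_1) ... t_(j+n-1)(a_n). Then
     t_j(a) c_n(j+1, a) = c_(n+1)(j, a) - c_(n+1)(j, a+1),
   so peeling off the smallest index gives a telescoping sum. By induction on
   [n], the sum over the chains below [N] differs from c_n by O(|q|^N);
   geometric domination of the terms turns this into unconditional
   summability. *)
Require Import Defs.
From mathcomp Require Import sequences ring zify.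

Set Implicit Arguments.
Unset Strict Implicit.
Unset Printing Implicit Defensive.
Import Order.TTheory GRing.Theory Num.Theory.
Local Open Scope ring_scope.

(** * Finite lists of truncated chains *)

Fixpoint chains (n x N : nat) : seq (seq nat) :=
  if n is n'.+1 then [seq a :: l | a <- index_iota x N, l <- chains n' a N]
  else [:: [::]].

Lemma mem_chains n x N s :
  (s \in chains n x N) =
  [&& size s == n, path leq x s & all (fun a => a < N)%N s].
Proof.
elim: n x s => [|n IHn] x s /=; first by case: s.
apply/allpairsPdep/idP => [[a [l [+ + ->]]]|].
  rewrite mem_index_iota IHn /= eqSS => /andP[-> ->] /and3P[-> -> ->] //.
case: s => [|a l] //=; rewrite eqSS => /and3P[sl /andP[xa al] /andP[aN lN]].
by exists a, l; rewrite mem_index_iota xa aN IHn sl al lN.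
Qed.

Lemma uniq_chains n x N : uniq (chains n x N).
Proof.
elim: n x => [|n IHn] x //=; apply: allpairs_uniq_dep => [|a _|]//.
  exact: iota_uniq.
by move=> [a l] [a' l'] /= _ _ [-> ->].
Qed.

Lemma sum_chainsS (V : nmodType) (f : seq nat -> V) n x N :
  \sum_(s <- chains n.+1 x N) f s =
  \sum_(x <= a < N) \sum_(s <- chains n a N) f (a :: s).
Proof. by rewrite big_allpairs_dep. Qed.

(** The offset [j] makes the tail of a chain, whose factors are numbered from [j.+1], an instance of
    the same form. *)
Definition chain_term (F : comNzRingType) (t : nat -> nat -> F) (j : nat)
    (s : seq nat) : F := \prod_(i < size s) t (j + i)%N (nth 0%N s i).

Lemma chain_term_cons (F : comNzRingType) (t : nat -> nat -> F) j a s :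
  chain_term t j (a :: s) = t j a * chain_term t j.+1 s.
Proof.
rewrite /chain_term big_ord_recl addn0; congr (_ * _).
by apply: eq_bigr => i _ /=; rewrite /bump add1n addSnnS.
Qed.

(** * Geometric bounds and sums over truncated chains *)

Lemma sum_expr_le (F : numFieldType) (r : F) x N : 0 <= r -> r < 1 ->
  \sum_(x <= a < N) r ^+ a <= (1 - r)^-1.
Proof.
move=> r0 r1; have d0 : 0 < 1 - r by rewrite subr_gt0.
case: (leqP x N) => [xN|/ltnW Nx]; last by rewrite big_geq // invr_ge0 ltW.
rewrite -[leRHS]mul1r ler_pdivlMr // mulr_suml.
under eq_bigr do rewrite mulrBr mulr1 -exprSr -opprB.
rewrite sumrN telescope_sumr // opprB.
by rewrite (le_trans (y := r ^+ x)) ?gerBl ?exprn_ge0 ?exprn_ile1 // ltW.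
Qed.

(** The bound on the tail is uniform in its lower bound [a], so each entry costs one factor
    [(1 - r)^-1]. *)
Lemma sum_chains_expr_le (F : numFieldType) (r : F) n x N : 0 <= r -> r < 1 ->
  \sum_(s <- chains n x N) r ^+ sumn s <= (1 - r)^-1 ^+ n.
Proof.
move=> r0 r1; elim: n x => [|n IHn] x; first by rewrite big_seq1.
rewrite sum_chainsS exprS.
apply: (@le_trans _ _ (\sum_(x <= a < N) r ^+ a * (1 - r)^-1 ^+ n)).
  apply: ler_sum => a _; rewrite /=.
  under eq_bigr do rewrite exprD.
  by rewrite -mulr_sumr ler_wpM2l ?exprn_ge0.
rewrite -mulr_suml ler_wpM2r ?sum_expr_le //.
by rewrite exprn_ge0 // invr_ge0 subr_ge0 ltW.
Qed.

Lemma norm_chain_term_le (F : numFieldType) (t : nat -> nat -> F) (K r : F) :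
  (forall j a, `|t j a| <= K * r ^+ a) ->
  forall j s, `|chain_term t j s| <= K ^+ size s * r ^+ sumn s.
Proof.
move=> tK j s; elim: s j => [|a s IHs] j.
  by rewrite /chain_term big_ord0 normr1 mulr1.
by rewrite chain_term_cons normrM /= exprS exprD mulrACA ler_pM.
Qed.

(* Peeling off the first index of a chain: the telescoping of the weights [c]
   is exact up to the boundary term at [N], and the error made by truncating
   the remaining indices at [N] is summed against [t]. *)
Lemma sum_chains_near (F : numFieldType) (t : nat -> nat -> F)
    (c : nat -> nat -> nat -> F) (K r : F) :
  0 <= r -> r < 1 ->
  (forall j a, `|t j a| <= K * r ^+ a) ->
  (forall j a, c 0%N j a = 1) ->
  (forall n j a, t j a * c n j.+1 a = c n.+1 j a - c n.+1 j a.+1) ->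
  (forall n, exists B, forall j a, `|c n.+1 j a| <= B * r ^+ a) ->
  forall n, exists2 D, 0 <= D & forall j x N, (x <= N)%N ->
    `|\sum_(s <- chains n x N) chain_term t j s - c n j x| <= D * r ^+ N.
Proof.
move=> r0 r1 tK c0 cS cB; have K0 : 0 <= K.
  by have := tK 0%N 0%N; rewrite mulr1; apply: le_trans.
elim=> [|n [D D0 IHn]].
  exists 0 => // j x N _; rewrite big_seq1 /chain_term big_ord0 c0 subrr.
  by rewrite normr0 mul0r.
have [B cnB] := cB n.
have B0 : 0 <= B by have := cnB 0%N 0%N; rewrite mulr1; apply: le_trans.
(* [B] pays for the boundary term at [N]; the inductive error [D * r ^+ N] is weighted by [t], whose
   sum over [a] is at most [K * (1 - r)^-1]. *)
exists (B + K * (1 - r)^-1 * D).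
  by rewrite addr_ge0 // !mulr_ge0 // invr_ge0 subr_ge0 ltW.
move=> j x N xN; rewrite sum_chainsS.
under eq_bigr do under eq_bigr do rewrite chain_term_cons.
under eq_bigr do rewrite -mulr_sumr.
have -> : c n.+1 j x = c n.+1 j N + \sum_(x <= a < N) t j a * c n j.+1 a.
  under eq_bigr do rewrite cS -opprB.
  by rewrite sumrN telescope_sumr // opprB addrC subrK.
rewrite opprD addrCA -sumrB mulrDl.
under eq_bigr do rewrite -mulrBr.
rewrite (le_trans (ler_normD _ _)) // lerD ?normrN //.
rewrite (le_trans (ler_norm_sum _ _ _)) //.
apply: (@le_trans _ _ (\sum_(x <= a < N) K * r ^+ a * (D * r ^+ N))).
  rewrite big_nat [leRHS]big_nat; apply: ler_sum => a /andP[_ aN].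
  by rewrite normrM ler_pM // IHn // ltnW.
rewrite -mulr_suml -mulr_sumr -mulrA -[leRHS]mulrA -[leRHS]mulrA ler_wpM2l //.
by rewrite ler_wpM2r ?sum_expr_le // mulr_ge0 ?exprn_ge0.
Qed.

Lemma leq_sumn_has N s : has (leq N) s -> (N <= sumn s)%N.
Proof.
elim: s => //= a s IHs /orP[/leq_trans-> //|/IHs h]; first exact: leq_addr.
exact: leq_trans h (leq_addl _ _).
Qed.

Lemma ler_sum_subset (F : numDomainType) (T : eqType) (s1 s2 : seq T)
    (f : T -> F) : uniq s1 -> {subset s1 <= s2} -> (forall x, 0 <= f x) ->
  \sum_(x <- s1) f x <= \sum_(x <- s2) f x.
Proof.
elim: s1 s2 => [|x s1 IHs1] s2 /=; first by move=> *; rewrite big_nil sumr_ge0.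
move=> /andP[xs1 us1] sub f0.
have xs2 : x \in s2 by rewrite sub ?mem_head.
rewrite big_cons (perm_big _ (perm_to_rem xs2)) big_cons lerD2l IHs1 // => y ys1.
have := sub y; rewrite inE ys1 orbT (perm_mem (perm_to_rem xs2)) inE.
by case/(_ isT)/predU1P => // yx; rewrite -yx ys1 in xs1.
Qed.

(** * The weights and their telescoping identity *)

Lemma qpochS (F : comNzRingType) (x q : F) n :
  qpoch x q n.+1 = qpoch x q n * (1 - x * q ^+ n).
Proof. by rewrite /qpoch big_ord_recr. Qed.

Definition qterm (F : fieldType) (q b : F) (m j a : nat) : F :=
  q ^+ (m * a) / \prod_(1 <= k < m.+2) (1 + b * q ^+ (j * m.+1 + k + a)).

(* The sum over [a <= a_1 <= ... <= a_n] of the product of the weights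
   [qterm q b m (j + i) a_(i+1)]. *)
Definition qsum (F : fieldType) (q b : F) (m n j a : nat) : F :=
  q ^+ (m * n * a) / (qpoch (q ^+ m) (q ^+ m) n *
    \prod_(1 <= k < (m * n).+1) (1 + b * q ^+ (j * m.+1 + k + a))).

(** Over the full product of [g k] for [1 <= k <= M + 1], the left side has every factor, the first
    term on the right lacks the last and the second lacks the first. What remains is
    [g (M + 1) - q ^+ M * g 1 = 1 - q ^+ M], the new factor of the Pochhammer symbol. *)
Lemma qsum_telescope (F : fieldType) (q b : F) m n j a :
  (forall N, (0 < N)%N -> 1 + b * q ^+ N != 0) ->
  (forall k, qpoch (q ^+ m) (q ^+ m) k != 0) ->
  qterm q b m j a * qsum q b m n j.+1 a =
  qsum q b m n.+1 j a - qsum q b m n.+1 j a.+1.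
Proof.
move=> hb hP; rewrite /qterm /qsum qpochS.
have := hP n.+1; rewrite qpochS mulf_eq0 negb_or => /andP[].
rewrite -exprM -exprD -mulnS; set P := qpoch _ _ _ => P0 Q0.
set M := (m * n.+1)%N; pose g k := 1 + b * q ^+ (j * m.+1 + k + a).
have g0 k : (0 < k)%N -> g k != 0 by move=> k0; apply: hb; lia.
have prod0 u v : (0 < u)%N -> \prod_(u <= k < v) g k != 0.
  move=> u0; rewrite prodf_seq_neq0; apply/allP => k.
  by rewrite mem_index_iota => /andP[uk _]; apply/g0/(leq_trans u0).
(* Raising [j] by one shifts the window of factors by [m.+1]; raising [a] by one shifts it by
   one. *)
have -> : \prod_(1 <= k < (m * n).+1) (1 + b * q ^+ (j.+1 * m.+1 + k + a)) =
    \prod_(m.+2 <= k < M.+2) g k.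
  rewrite (big_addn 1 _ m.+1).
  have -> : (M.+2 - m.+1)%N = (m * n).+1 by rewrite /M; lia.
  by apply: eq_bigr => k _; congr (1 + b * q ^+ _); lia.
have -> : \prod_(1 <= k < M.+1) (1 + b * q ^+ (j * m.+1 + k + a.+1)) =
    \prod_(2 <= k < M.+2) g k.
  by rewrite [RHS]big_add1; apply: eq_bigr => k _; congr (1 + b * q ^+ _); lia.
rewrite -[\prod_(1 <= k < m.+2) _]/(\prod_(1 <= k < m.+2) g k).
rewrite -[\prod_(1 <= k < M.+1) _]/(\prod_(1 <= k < M.+1) g k) mulf_div.
have splitM : \prod_(1 <= k < m.+2) g k * \prod_(m.+2 <= k < M.+2) g k =
    \prod_(1 <= k < M.+2) g k by rewrite -big_cat_nat // /M; lia.
rewrite mulrCA splitM.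
have gl : \prod_(1 <= k < M.+2) g k = g 1%N * \prod_(2 <= k < M.+2) g k.
  by rewrite big_ltn.
have gr : \prod_(1 <= k < M.+2) g k = \prod_(1 <= k < M.+1) g k * g M.+1.
  by rewrite big_nat_recr.
have h1 := g0 1%N isT; have h2 := g0 M.+1 isT.
have := prod0 1%N M.+2 isT; have := prod0 2%N M.+2 isT.
have := prod0 1%N M.+1 isT.
(* Both shorter products are expressed through the full one, leaving [field] a single atom [G]. *)
have -> : \prod_(2 <= k < M.+2) g k = \prod_(1 <= k < M.+2) g k / g 1%N.
  by rewrite gl mulrC mulKf.
have -> : \prod_(1 <= k < M.+1) g k = \prod_(1 <= k < M.+2) g k / g M.+1.
  by rewrite gr mulfK.
set G := \prod_(1 <= k < M.+2) g k => _ _ G0.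
have -> : q ^+ (m * a) * q ^+ (m * n * a) = q ^+ (M * a).
  by rewrite -exprD; congr (_ ^+ _); rewrite /M; lia.
have -> : q ^+ (M * a.+1) = q ^+ (M * a) * q ^+ M by rewrite mulnS addnC exprD.
have gM : g M.+1 = 1 + b * q ^+ (j * m.+1 + 1 + a) * q ^+ M.
  by rewrite -mulrA -exprD; congr (1 + b * _ ^+ _); lia.
move: h1 h2; rewrite gM /g => h1 h2.
by field; rewrite P0 Q0 G0 h1 h2.
Qed.

(** * From truncated sums to unconditional summability *)

Lemma complex_expr_small (R : realType) (r e : R[i]) :
  0 <= r -> r < 1 -> 0 < e -> exists N, r ^+ N < e.
Proof.
move=> r0 r1 e0.
have rE : r = (complex.Re r)%:C%C by rewrite RRe_real // ger0_real.
have eE : e = (complex.Re e)%:C%C by rewrite RRe_real // gtr0_real.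
move: r0 r1 e0; rewrite rE eE; move: (complex.Re r) (complex.Re e) => x y.
rewrite -(rmorph0 (@real_complex R)) -(rmorph1 (@real_complex R)) lecR !ltcR.
move=> x0 x1 y0.
have /cvgrPdist_lt/(_ _ y0) [N _ /(_ N (leqnn N))] : (x ^+ n @[n --> \oo] --> 0)%classic.
  by apply: cvg_expr; rewrite ger0_norm.
rewrite /= sub0r normrN ger0_norm ?exprn_ge0 // => xN.
by exists N; rewrite -rmorphXn /= ltcR.
Qed.

(** The two [insub] restore the length and the sortedness in turn; chains from 0 have both, so none
    is discarded. *)
Definition chain_fset (n N : nat) : {fset ndtuple n} :=
  [fset a | a in (pmap insub (pmap insub (chains n 0 N) : seq (n.-tuple nat))
                   : seq (ndtuple n))]%fset.

Lemma mem_chain_fset n N (a : ndtuple n) :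
  (a \in chain_fset n N) = (tval (val a) \in chains n 0 N).
Proof. by rewrite in_fset /= !mem_pmap_sub. Qed.

Lemma path_leq0 s : path leq 0%N s = sorted leq s.
Proof. by case: s. Qed.

Lemma mem_chains_ndtuple n N (a : ndtuple n) :
  (tval (val a) \in chains n 0 N) = all (fun x => x < N)%N (val a).
Proof. by rewrite mem_chains size_tuple eqxx path_leq0 (valP a). Qed.

Lemma perm_chain_fset n N :
  perm_eq [seq tval (val a) | a <- chain_fset n N] (chains n 0 N).
Proof.
apply: uniq_perm; [|exact: uniq_chains|move=> s].
  by rewrite map_inj_uniq ?fset_uniq // => a b /val_inj/val_inj.
apply/mapP/idP => [[a aN ->]|sN]; first by rewrite -mem_chain_fset.
have := sN; rewrite mem_chains path_leq0 => /and3P[sz srt _].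
by exists (exist _ (Tuple sz) srt) => //; rewrite mem_chain_fset.
Qed.

(** A finite index set containing the box of side [N] splits into the box, controlled by hypothesis,
    and chains with an entry at least [N], controlled by geometric domination. *)
Lemma has_sum_chains (R : realType) (t : nat -> nat -> R[i]) (n : nat)
    (K D r v : R[i]) :
  0 <= r -> r < 1 -> (forall j a, `|t j a| <= K * r ^+ a) ->
  (forall N,
    `|\sum_(s <- chains n 0 N) chain_term t 0 s - v| <= D * r ^+ N) ->
  has_sum (fun a : ndtuple n => chain_term t 0 (val (val a))) v.
Proof.
move=> r0 r1 tK tD; have K0 : 0 <= K.
  by have := tK 0%N 0%N; rewrite mulr1; apply: le_trans.
have D0 : 0 <= D by have := tD 0%N; rewrite mulr1; apply: le_trans.
(* Splitting [r] as the square of [s] leaves a factor [s ^+ N] for the terms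
   outside the box of side [N], while the other factor remains summable. *)
pose s := sqrtC r; have rs : r = s ^+ 2 by rewrite sqrtCK.
have s0 : 0 <= s by rewrite sqrtC_ge0.
have s1 : s < 1 by rewrite -(@expr_lt1 _ 2) // -rs.
have M0 : 0 <= (1 - s)^-1 by rewrite invr_ge0 subr_ge0 ltW.
have FF := @summability.totally_filter (ndtuple n).
apply/(@cvgrPdist_lt _ R[i]^o) => e e0.
pose E := D + K ^+ n * (1 - s)^-1 ^+ n.
have E0 : 0 <= E by rewrite addr_ge0 // mulr_ge0 // exprn_ge0.
(* [E] may be 0, hence the division by [E + 1]. *)
have [N sN] : exists N, s ^+ N < e / (E + 1).
  by apply: complex_expr_small => //; rewrite divr_gt0 // ltr_wpDl.
exists (chain_fset n N) => //= J /= NJ.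
pose f (a : ndtuple n) := chain_term t 0 (val (val a)).
have -> : summability.partial_sum f J = \sum_(a <- J) f a.
  by rewrite big_seq_fsetE.
rewrite (bigID (mem (chain_fset n N))) /=.
have -> : \sum_(a <- J | a \in chain_fset n N) f a =
    \sum_(x <- chains n 0 N) chain_term t 0 x.
  rewrite -(perm_big _ (perm_chain_fset n N)) big_map -[LHS]big_filter.
  apply: perm_big.
  apply: uniq_perm; rewrite ?filter_uniq ?fset_uniq // => a.
  by rewrite mem_filter andb_idr // => /(fsubsetP NJ).
have tail : `|\sum_(a <- J | a \notin chain_fset n N) f a| <=
    K ^+ n * (1 - s)^-1 ^+ n * s ^+ N.
  rewrite (le_trans (ler_norm_sum _ _ _)) //.
  apply: (@le_trans _ _
      (\sum_(a <- J) K ^+ n * s ^+ N * s ^+ sumn (val (val a)))).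
    rewrite [leRHS](bigID (mem (chain_fset n N))) /=.
    rewrite ler_wpDl ?sumr_ge0 // => [a _|]; first by rewrite !mulr_ge0 ?exprn_ge0.
    apply: ler_sum => a; rewrite mem_chain_fset mem_chains_ndtuple -has_predC => aN.
    rewrite (le_trans (norm_chain_term_le tK _ _)) // size_tuple -mulrA.
    rewrite ler_wpM2l ?exprn_ge0 // rs -exprM mul2n -addnn exprD.
    rewrite ler_wpM2r ?exprn_ge0 // ler_wiXn2l // ?ltW // leq_sumn_has //.
    by apply: sub_has aN => x /=; rewrite -leqNgt.
  rewrite -mulr_sumr mulrAC ler_wpM2r ?exprn_ge0 // ler_wpM2l ?exprn_ge0 //.
  pose S := [seq tval (val a) | a <- J].
  rewrite -(big_map (fun a : ndtuple n => tval (val a)) xpredT (fun x => s ^+ sumn x)).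
  (* This side is large enough for the box to contain all of [J]. *)
  pose N' := (\max_(x <- flatten S) x).+1.
  apply: le_trans (@sum_chains_expr_le _ s n 0 N' s0 s1).
  apply: ler_sum_subset => [|x xJ|x]; last by rewrite exprn_ge0.
    by rewrite map_inj_uniq ?fset_uniq // => a b /val_inj/val_inj.
  have /mapP[a aJ xE] := xJ; rewrite xE mem_chains_ndtuple; apply/allP => y ya.
  rewrite /N' ltnS; apply: (leq_bigmax_seq (F := id)) => //.
  by apply/flattenP; exists x => //; rewrite xE.
rewrite opprD addrA (le_lt_trans (ler_normB _ _)) //.
apply: (@le_lt_trans _ _ (E * s ^+ N)).
  rewrite mulrDl lerD // distrC (le_trans (tD N)) // ler_wpM2l //.
  by rewrite rs -exprM ler_wiXn2l ?(ltW s1) ?leq_pmull.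
apply: (@le_lt_trans _ _ ((E + 1) * s ^+ N)).
  by rewrite ler_wpM2r ?exprn_ge0 // lerDl.
by rewrite mulrC -ltr_pdivlMr // ltr_wpDl.
Qed.

(** * Uniform bounds on the factors, and the conclusion *)

Lemma norm_inv_le (F : numFieldType) (q b : F) :
  (forall e, 0 < e -> exists N, `|q| ^+ N < e) -> `|q| < 1 ->
  exists2 c, 0 <= c & forall N, `|(1 + b * q ^+ N)^-1| <= c.
Proof.
move=> small q1.
(* Once [q ^+ N] has norm below the inverse of this, [b * q ^+ N] has norm at most 1/2 and the
   inverse is at most 2. The finitely many earlier inverses are added to the bound; a vanishing
   denominator contributes 0. *)
have b0 : 0 < 2 * (`|b| + 1) by rewrite mulr_gt0 // ltr_wpDl.
have [N0 hN0] := small _ (etrans (invr_gt0 _) b0).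
exists (2 + \sum_(N < N0) `|(1 + b * q ^+ N)^-1|).
  by rewrite addr_ge0 // sumr_ge0.
move=> N; have [NN0|N0N] := ltnP N N0.
  rewrite (bigD1 (Ordinal NN0)) //= addrCA lerDl addr_ge0 // sumr_ge0 //.
have bq : `|b * q ^+ N| <= 2^-1.
  rewrite normrM normrX.
  apply: (@le_trans _ _ ((`|b| + 1) * (2 * (`|b| + 1))^-1)).
    rewrite ler_pM ?exprn_ge0 ?lerDl //.
    by rewrite (le_trans _ (ltW hN0)) // ler_wiXn2l // ltW.
  by rewrite invfM mulrCA divff ?mulr1 // gt_eqF // ltr_wpDl.
rewrite (le_trans (y := 2)) ?lerDl ?sumr_ge0 // normfV.
have half : 2^-1 <= `|1 + b * q ^+ N|.
  have := lerB_normD 1 (b * q ^+ N); rewrite normr1; apply: le_trans.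
  rewrite lerBrDr; apply: le_trans (_ : 2^-1 + 2^-1 <= 1); first by rewrite lerD2l.
  have -> : 2^-1 + 2^-1 = 1 :> F by field.
  exact: lexx.
by rewrite invf_ple ?posrE // (lt_le_trans _ half) ?invr_gt0.
Qed.

Theorem lemma3 (R : realType) (q b : R[i])
    (hq : `|q| < 1)
    (hb : forall N : nat, (0 < N)%N -> 1 + b * q ^+ N != 0)
    (m n : nat) (hm : (0 < m)%N) (hn : (0 < n)%N) :
  has_sum
    (fun a : ndtuple n =>
       q ^+ (m * \sum_(j < n) tnth (val a) j)
       / \prod_(j < n) \prod_(1 <= k < m.+2)
           (1 + b * q ^+ (j * m.+1 + k + tnth (val a) j)))
    (1 / (qpoch (q ^+ m) (q ^+ m) n * qpoch (- b * q) q (m * n))).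
Proof.
have poch0 k : qpoch (q ^+ m) (q ^+ m) k != 0.
  rewrite prodf_seq_neq0; apply/allP => i _ /=.
  rewrite -exprS -exprM subr_eq0 eq_sym.
  (* A zero factor would make a positive power of [q] equal to 1, against [hq]. *)
  apply/eqP => /(congr1 (fun z => `|z|)); rewrite normrX normr1 => /eqP.
  by rewrite lt_eqF // exprn_ilt1 // -lt0n muln_gt0 hm.
have [c c0 hc] : exists2 c, 0 <= c & forall N, `|(1 + b * q ^+ N)^-1| <= c.
  by apply: norm_inv_le => // e; apply: complex_expr_small.
have prod_le d j a : `|(\prod_(1 <= k < d.+1) (1 + b * q ^+ (j * m.+1 + k + a)))^-1|
    <= c ^+ d.
  rewrite -prodfV normr_prod.
  apply: (@le_trans _ _ (\prod_(1 <= k < d.+1) c)).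
    by apply: ler_prod => k _; rewrite normr_ge0 hc.
  by rewrite prodr_const_nat subn1.
have qle d a : (0 < d)%N -> `|q ^+ (d * a)| <= `|q| ^+ a.
  by move=> d0; rewrite normrX ler_wiXn2l ?(ltW hq) ?leq_pmull.
have tK j a : `|qterm q b m j a| <= c ^+ m.+1 * `|q| ^+ a.
  by rewrite normrM mulrC ler_pM // qle.
(* Decay in [a] starts at index 1: the weight of index 0 is constantly 1. *)
have qsumB k : exists B, forall j a, `|qsum q b m k.+1 j a| <= B * `|q| ^+ a.
  exists (`|(qpoch (q ^+ m) (q ^+ m) k.+1)^-1| * c ^+ (m * k.+1)) => j a.
  rewrite normrM mulrC ler_pM ?qle ?muln_gt0 ?hm //.
  by rewrite invfM normrM ler_wpM2l.
have qsum0 j a : qsum q b m 0 j a = 1.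
  by rewrite /qsum muln0 mul0n expr0 /qpoch big_ord0 big_geq // mulr1 divr1.
have [D D0 hD] := sum_chains_near (normr_ge0 q) hq tK qsum0
  (fun n j a => qsum_telescope n j a hb poch0) qsumB n.
have -> : 1 / (qpoch (q ^+ m) (q ^+ m) n * qpoch (- b * q) q (m * n)) =
    qsum q b m n 0 0.
  rewrite /qsum muln0 expr0; congr (_ / (_ * _)).
  rewrite big_add1 /= big_mkord /qpoch; apply: eq_bigr => k _.
  by rewrite mul0n add0n addn0 exprS mulrA !mulNr opprK.
have := has_sum_chains (normr_ge0 q) hq tK (hD 0%N 0%N ^~ (leq0n _)).
congr (has_sum _ _); apply/funext => a /=.
rewrite big_distrr /= expr_sum -prodf_div /chain_term.
rewrite size_tuple; apply: eq_bigr => j _.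
by rewrite (tnth_nth 0%N).
Qed.
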